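(* Let $\alpha\in(0,1)$, $\lambda,\mu>0$, and let $L^{\alpha,\alpha}_{\lambda,\mu}$ be the Mittag-Leffler GI/GI/1 queue length with equal tail indices $\alpha_1=\alpha_2=\alpha$. Then: \begin{enumerate} \item If $\mu\ge\lambda$, then $\mathbb P\{L^{\alpha,\alpha}_{\lambda,\mu}(t)=0\ \text{i.o.}\}=1$. \item If $\mu\le\lambda$, then there exists a constant $c_{\lambda,\mu}>0$ such that $\mathbb P\{\limsup_{t\to\infty}L^{\alpha,\alpha}_{\lambda,\mu}(t)=\infty\}>c_{\lambda,\mu}$. \end{enumerate}
   Context: Mittag-Leffler function: $E_{a,b}(x)=\sum_{\ell\ge 0}\frac{x^{\ell}}{\Gamma(b+a\ell)}$. For $\alpha\in(0,1)$ and $\lambda>0$, a Mittag-Leffler random variable $X_{\alpha,\lambda}$ with index $\alpha$ and scale $\lambda$ is positive with $\mathbb P\{X_{\alpha,\lambda}>x\}=E_{\alpha,1}(-\lambda^{\alpha}x^{\alpha})$, $x\ge0$. The fractional Poisson process $N^{(\alpha)}_{\lambda}(t)$ is the renewal counting process with $N^{(\alpha)}_\lambda(0)=0$ whose inter-event times are i.i.d. copies of $X_{\alpha,\lambda}$ (the first one starting at time $0$). Mittag-Leffler GI/GI/1 queue: the arrival process $N^{(\alpha_1)}_{\lambda}$ and the departure (service) process $N^{(\alpha_2)}_{\mu}$ are independent fractional Poisson processes, and the queue length is $$L^{\alpha_1,\alpha_2}_{\lambda,\mu}(t)=\big(N^{(\alpha_1)}_{\lambda}(t)-N^{(\alpha_2)}_{\mu}(t)\big)-\inf_{0\le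 s\le t}\big(N^{(\alpha_1)}_{\lambda}(s)-N^{(\alpha_2)}_{\mu}(s)\big),\qquad t\ge0.$$ The event $\{L(t)=0\ \text{i.o.}\}$ (infinitely often) means that $L(t)=0$ for arbitrarily large times $t$, i.e. $\{t\ge0:L(t)=0\}$ is unbounded. *)

(* Defs.v *)
From HB Require Import structures.
From mathcomp Require Import all_boot all_order all_algebra finmap.
From mathcomp Require Import all_classical all_reals all_analysis.
From mathcomp Require Import measurable_realfun.

Set Implicit Arguments.
Unset Strict Implicit.
Unset Printing Implicit Defensive.

Import Order.TTheory GRing.Theory Num.Theory.
Import numFieldNormedType.Exports.

Local Open Scope classical_set_scope.
Local Open Scope ring_scope.

Definition Gamma (R : realType) (z : R) : R :=
  \int[lebesgue_measure]_(x in `]0, +oo[) (x `^ (z - 1) * expR (- x)).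

(* The series converges for a > 0 and b > 0. *)
Definition mittag_leffler_fun (R : realType) (a b x : R) : R :=
  limn (series (fun l : nat => x ^+ l / Gamma (b + a * l%:R))).

Definition is_mittag_leffler (R : realType) (d : measure_display)
    (T : measurableType d) (P : probability T R) (alpha lambda : R)
    (X : {RV P >-> R}) : Prop :=
  (forall w, 0 < X w) /\
  (forall x, 0 <= x -> P [set w | x < X w] =
     (mittag_leffler_fun alpha 1 (- (lambda `^ alpha * x `^ alpha)))%:E).

Definition mutually_independent (R : realType) (d : measure_display)
    (T : measurableType d) (P : probability T R) (I : choiceType)
    (X : I -> {RV P >-> R}) : Prop :=
  forall (J : {fset I}) (B : I -> set R), (forall i, measurable (B i)) ->
  P (\bigcap_(i in [set` J]) (X i @^-1` B i)) =
  (\prod_(i <- J) P (X i @^-1` B i))%E.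

Definition renewal_epoch (R : realType) (T : Type) (X : nat -> T -> R)
    (n : nat) (w : T) : R :=
  \sum_(i < n) X i w.

(* The number of epochs S_1, S_2, ... lying in [0, t]. It is +oo when infinitely
   many of them do, which for i.i.d. positive inter-event times happens only on
   a null set. *)
Definition renewal_count (R : realType) (T : Type) (X : nat -> T -> R)
    (t : R) (w : T) : \bar R :=
  counting [set n : nat | renewal_epoch X n.+1 w <= t].

(* Processes are functions R -> T -> \bar R of which only the values at times
   t >= 0 are meaningful. *)
Definition fractional_poisson_process (R : realType) (d : measure_display)
    (T : measurableType d) (P : probability T R) (alpha lambda : R)
    (N : R -> T -> \bar R) : Prop :=
  exists X : nat -> {RV P >-> R},
    [/\ mutually_independent X,
        forall n, is_mittag_leffler alpha lambda (X n) &
        forall t w, 0 <= t -> N t w = renewal_count X t w].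

Definition process_sigma_algebra (R : realType) (T : Type)
    (N : R -> T -> \bar R) : set (set T) :=
  <<s [set A | exists t : R, exists B : set (\bar R),
         [/\ 0 <= t, measurable B & A = N t @^-1` B]] >>.

Definition independent_processes (R : realType) (d : measure_display)
    (T : measurableType d) (P : probability T R)
    (N1 N2 : R -> T -> \bar R) : Prop :=
  forall A B, process_sigma_algebra N1 A -> process_sigma_algebra N2 B ->
  P (A `&` B) = (P A * P B)%E.

Definition queue_length (R : realType) (T : Type)
    (N1 N2 : R -> T -> \bar R) (t : R) (w : T) : \bar R :=
  ((N1 t w - N2 t w) -
   ereal_inf [set N1 s w - N2 s w | s in `[0%R, t]%classic])%E.

Definition mittag_leffler_queue (R : realType) (d : measure_display)
    (T : measurableType d) (P : probability T R)
    (alpha1 alpha2 lambda mu : R) (L : R -> T -> \bar R) : Prop :=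
  exists N1 N2 : R -> T -> \bar R,
    [/\ fractional_poisson_process P alpha1 lambda N1,
        fractional_poisson_process P alpha2 mu N2,
        independent_processes P N1 N2 &
        forall t w, 0 <= t -> L t w = queue_length N1 N2 t w].

Definition zero_infinitely_often (R : realType) (T : Type)
    (L : R -> T -> \bar R) : set T :=
  [set w | forall M : R, exists t, [/\ 0 <= t, M <= t & L t w = 0%E]].

Definition limsup_infinite (R : realType) (T : Type)
    (L : R -> T -> \bar R) : set T :=
  [set w | limf_esup (fun t => L t w) (pinfty_nbhs R) = +oo%E].

(* Main.v *)
From HB Require Import structures.
Require Import Defs.
From mathcomp Require Import all_boot all_order all_algebra finmap.
From mathcomp Require Import all_classical all_reals all_analysis.
From mathcomp Require Import measurable_realfun lra zify.

(** Both parts hold with probability one, and both come from one fact about a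
symmetric random walk.

Let [S1 n] and [S2 n] be the [n]-th arrival and service epochs. The count of
arrivals exceeds that of services by more than [k] at time [S1 (k + n)] as soon
as [S1 (k + n) < S2 n]. If this happens for some [n] whatever [k] is, the queue
length is unbounded, hence its limsup is infinite, because the counts are
finite at every time. If on the contrary [S2 (k + n) < S1 n] for some [n]
whatever [k] is, the netput process [N1 - N2] is unbounded below; being
integer valued it attains its minimum over each bounded interval, and the queue
is empty at such a minimum, which can be taken arbitrarily late
([queue_length_unbounded], [queue_length_zeros_unbounded]).

A Mittag-Leffler variable of scale [lambda] is [1 / lambda] times one of scale
one, so that the steps [lambda * X1 n] and [mu * X2 n] form a single family of
independent and identically distributed variables. If [lambda <= mu] it is
enough to find [n] with [mu * S2 (k + n) < lambda * S1 n], and symmetrically if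
[mu <= lambda]. After a shift of one of the two sequences by [k] indices this
asks the symmetric random walk [lambda * S1 n - mu * S2 n] to be unbounded
above ([ae_partial_sum_lead]).

That walk is unbounded for any common law that is not a Dirac mass. Its
oscillation is almost surely infinite, since long runs of large increments
happen with positive probability independently of the future
([walk_osc_null]). Being bounded above is a tail event, so its probability is
[0] or [1] ([iid_zero_one]); exchanging the two sequences shows that being
bounded below has the same probability, and the two together are impossible
([walk_not_bounded_above]).

The tail index enters only through the scaling and through the fact that the
law is not a Dirac mass: otherwise the Mittag-Leffler power series would be
constant near [0], although its first coefficient [1 / Gamma (1 + alpha)] is
not zero ([is_mittag_leffler_nondegenerate]).

Finally the two events are measurable because the counts, hence the queue
length, are constant on a small interval to the right of each time: rational
times suffice ([measurable_at_arbitrarily_large_times]). *)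

Set Implicit Arguments.
Unset Strict Implicit.
Unset Printing Implicit Defensive.

Import Order.TTheory GRing.Theory Num.Theory.
Import numFieldNormedType.Exports.

Local Open Scope classical_set_scope.
Local Open Scope ring_scope.

(** * Families of independent and identically distributed variables *)

Lemma prode_fsetU (R : realType) (I : choiceType) (J K : {fset I})
    (F : I -> \bar R) : [disjoint J & K]%fset ->
  (\prod_(i <- (J `|` K)%fset) F i =
   (\prod_(i <- J) F i) * (\prod_(i <- K) F i))%E.
Proof.
move=> JK; rewrite -big_cat; apply: perm_big; apply: uniq_perm => [||i].
- exact: fset_uniq.
- rewrite cat_uniq !fset_uniq andbT /= -all_predC; apply/allP => i iK /=.
  by apply/negP => iJ; move/fdisjointP : JK => /(_ i iJ); rewrite iK.
- by rewrite inE mem_cat.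
Qed.

Section trajectories.
Context {R : realType} {I : choiceType}.

Definition cylinder (J : {fset I}) (B : I -> set R) : set (I -> R) :=
  [set z | forall i, i \in J -> B i (z i)].

Definition cylinders : set (set (I -> R)) :=
  [set E | exists J B, (forall i, measurable (B i)) /\ E = cylinder J B].

(** The space of trajectories [I -> R] with its product sigma-algebra. *)
Definition trajectory := g_sigma_algebraType cylinders.

Lemma measurable_cylinder J B : (forall i, measurable (B i)) ->
  measurable (cylinder J B : set trajectory).
Proof. by move=> mB; apply: sub_sigma_algebra; exists J, B. Qed.

Lemma setI_closed_cylinders : setI_closed cylinders.
Proof.
move=> _ _ [J [B [mB ->]]] [K [C [mC ->]]].
exists (J `|` K)%fset, (fun i => (if i \in J then B i else setT) `&`
                       (if i \in K then C i else setT)).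
split=> [i|]; first by apply: measurableI; case: ifP.
apply/seteqP; split=> [z [zB zC] i|z zBC].
  by split; case: ifP => // ?; [exact: zB|exact: zC].
split=> i iJ; have := zBC i; rewrite inE iJ ?orbT => /(_ isT)[].
  by [].
by [].
Qed.

Lemma measurable_coord i : measurable_fun setT (fun z : trajectory => z i).
Proof.
move=> _ B mB; rewrite setTI.
rewrite [X in measurable X](_ : _ = cylinder [fset i]%fset (fun=> B)).
  exact: measurable_cylinder.
apply/seteqP; split=> [z zB j|z]; first by rewrite inE => /eqP ->.
by apply; rewrite inE.
Qed.

Lemma measurable_trajectory d (T : measurableType d) (Z : I -> T -> R) :
  (forall i, measurable_fun setT (Z i)) ->
  measurable_fun setT (fun w => Z^~ w : trajectory).
Proof.
move=> mZ; apply: (@measurability _ _ T trajectory _ _ cylinders (erefl _)).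
move=> _ [_ [J [B [mB ->]]] <-]; rewrite setTI.
rewrite [X in measurable X](_ : _ =
    \bigcap_(i in [set` J]) (Z i @^-1` B i)); last first.
  by apply/seteqP; split=> w.
apply: fin_bigcap_measurable; first exact: finite_fset.
by move=> i _; rewrite -[X in measurable X]setTI; exact: mZ.
Qed.

(** Cylinders are stable under intersection and generate the product
sigma-algebra, so the pi-lambda theorem applies. All the identities about
independent families below are obtained from this one. *)
Lemma trajectory_measure_unique (m1 m2 : {measure set trajectory -> \bar R}) :
  (m1 setT < +oo)%E ->
  (forall J B, (forall i, measurable (B i)) ->
    m1 (cylinder J B) = m2 (cylinder J B)) ->
  forall E, measurable E -> m1 E = m2 E.
Proof.
move=> m1T m12 E mE; apply: (@measure_unique _ R trajectory cylinders (fun=> setT)) => //.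
- exact: setI_closed_cylinders.
- move=> _; exists fset0, (fun=> setT); split=> //.
  by apply/seteqP; split=> z.
- by apply/seteqP; split => // z _; exists 0%N.
- by move=> _ [J [B [mB ->]]]; exact: m12.
Qed.

End trajectories.
Arguments trajectory : clear implicits.

Section iid.
Context {R : realType} {d : measure_display} {T : measurableType d}.
Context {P : probability T R} {I : choiceType}.
Implicit Types (Z : I -> {RV P >-> R}) (E : set (trajectory R I)).

Definition iid Z := mutually_independent Z /\
  forall i j B, measurable B -> P (Z i @^-1` B) = P (Z j @^-1` B).

(** The random trajectory, read through a reindexing [f] of the family. *)
Definition sample Z (f : I -> I) : T -> trajectory R I := fun w i => Z (f i) w.

Lemma measurable_sample Z f : measurable_fun setT (sample Z f).
Proof. by apply: measurable_trajectory => i. Qed.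

Lemma measurable_sampleP Z f E : measurable E -> measurable (sample Z f @^-1` E).
Proof.
by move=> mE; rewrite -[X in measurable X]setTI; exact: measurable_sample.
Qed.

Section sample_law.
Variables (m : {measure set T -> \bar R}) (Z : I -> {RV P >-> R}) (f : I -> I).

Definition sample_law : set (trajectory R I) -> \bar R := pushforward m (sample Z f).

Let mZ := measurable_sample Z f.

Let sample_law0 : sample_law set0 = 0%E.
Proof. exact: measure0. Qed.

Let sample_law_ge0 E : (0 <= sample_law E)%E.
Proof. exact: measure_ge0. Qed.

Let sample_law_sigma_additive : semi_sigma_additive sample_law.
Proof. exact: measure_semi_sigma_additive. Qed.

HB.instance Definition _ := isMeasure.Build _ _ _ sample_law
  sample_law0 sample_law_ge0 sample_law_sigma_additive.

End sample_law.

(** As functions of [E] both sides are finite measures, and on a cylinder they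
are the same product of probabilities. With [J] empty this is invariance in
law under reindexing; in general it also gives independence from finitely many
coordinates that [f] avoids. *)
Lemma iid_reindex Z f g J B E : iid Z -> cancel f g ->
  (forall i, f i \notin J) -> (forall i, measurable (B i)) -> measurable E ->
  P (sample Z id @^-1` cylinder J B `&` sample Z f @^-1` E) =
  (P (sample Z id @^-1` cylinder J B) * P (sample Z id @^-1` E))%E.
Proof.
move=> [indZ idZ] fK fJ mB mE.
have mF : measurable (sample Z id @^-1` cylinder J B).
  by apply: measurable_sampleP; exact: measurable_cylinder.
set F := _ @^-1` cylinder J B in mF *.
have p0 : 0 <= fine (P F) by rewrite fine_ge0.
pose m1 := sample_law (mrestr P mF) Z f.
pose m2 := mscale (NngNum p0) (sample_law P Z id).
have <- : m1 E = P (F `&` sample Z f @^-1` E) by rewrite setIC.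
have <- : m2 E = (P F * P (sample Z id @^-1` E))%E.
  by rewrite /m2 /mscale /= fineK// fin_num_measure.
apply: trajectory_measure_unique => //.
  change (P (setT `&` F) < +oo)%E.
  by rewrite setTI -ge0_fin_numE ?fin_num_measure.
move=> K C mC.
change (P (sample Z f @^-1` cylinder K C `&` F) =
  (fine (P F))%:E * P (sample Z id @^-1` cylinder K C))%E.
rewrite fineK ?fin_num_measure//.
have cylE L D : sample Z id @^-1` cylinder L D = \bigcap_(i in [set` L]) (Z i @^-1` D i).
  by apply/seteqP; split=> w.
have -> : sample Z f @^-1` cylinder K C `&` F = \bigcap_(i in [set` (J `|` f @` K)%fset])
   (Z i @^-1` (if i \in J then B i else C (g i))).
  apply/seteqP; split=> [w [wC wF] i|w wBC].
    rewrite /= !inE; case: ifPn => [iJ _|iJ /= /imfsetP[j /= jK] ij].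
      exact: wF.
    by rewrite ij fK; exact: wC.
  split=> i iJ.
    have /= := wBC (f i); rewrite !inE (negPf (fJ i)) /= fK; apply.
    by apply/imfsetP; exists i.
  by have /= := wBC i; rewrite !inE iJ; apply.
rewrite /F !cylE !indZ//; last by move=> i; case: ifP.
rewrite prode_fsetU; last first.
  apply/fdisjointP => i iJ; apply/imfsetP => -[j /= _ ij].
  by move: (fJ j); rewrite -ij iJ.
congr (_ * _)%E; first by apply: eq_big_seq => i /= ->.
rewrite big_imfset/=; last by move=> ? ? _ _ /(can_inj fK).
by apply: eq_bigr => i _; rewrite (negPf (fJ i)) fK; exact: idZ.
Qed.

Lemma iid_reindex_law Z f g E : iid Z -> cancel f g -> measurable E ->
  P (sample Z f @^-1` E) = P (sample Z id @^-1` E).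
Proof.
move=> iZ fK mE.
have := @iid_reindex Z f g fset0 (fun=> setT) E iZ fK (fun i => isT)
  (fun=> measurableT) mE.
rewrite [X in sample Z id @^-1` X](_ : _ = setT) ?preimage_setT; last first.
  by apply/seteqP; split=> z.
by rewrite setTI probability_setT mul1e.
Qed.

(** Kolmogorov's zero-one law. By [iid_reindex], an event insensitive to
reindexings that avoid any given finite set is independent of every cylinder,
hence by [trajectory_measure_unique] of every event, hence of itself. *)
Lemma iid_zero_one Z E : iid Z -> measurable E ->
  (forall J : {fset I}, exists f g : I -> I, [/\ cancel f g,
     forall i, f i \notin J & forall z : I -> R, E (z \o f) <-> E z]) ->
  P (sample Z id @^-1` E) = 0%E \/ P (sample Z id @^-1` E) = 1%E.
Proof.
move=> iZ mE tailE.
have mF := measurable_sampleP Z id mE.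
set F := _ @^-1` E in mF *.
have p0 : 0 <= fine (P F) by rewrite fine_ge0.
pose m1 := sample_law (mrestr P mF) Z id.
pose m2 := mscale (NngNum p0) (sample_law P Z id).
have /(_ E mE) : forall A, measurable A -> m1 A = m2 A.
  apply: trajectory_measure_unique => //.
    change (P (setT `&` F) < +oo)%E.
    by rewrite setTI -ge0_fin_numE ?fin_num_measure.
  move=> J B mB; have [f [g [fK fJ fE]]] := tailE J.
  change (P (sample Z id @^-1` cylinder J B `&` F) =
    (fine (P F))%:E * P (sample Z id @^-1` cylinder J B))%E.
  rewrite fineK ?fin_num_measure// muleC {1}(_ : F = sample Z f @^-1` E).
    by rewrite (iid_reindex iZ fK fJ mB mE).
  by apply/seteqP; split=> w Ew; have [] := fE (sample Z id w); tauto.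
change (P (F `&` F) = (fine (P F))%:E * P F -> P F = 0 \/ P F = 1)%E; rewrite setIid.
have [p ->] : exists p, P F = p%:E.
  by exists (fine (P F)); rewrite fineK ?fin_num_measure.
rewrite -EFinM => -[] /eqP; rewrite -subr_eq0 -{1}[p]mul1r -mulrBl.
by rewrite mulf_eq0 subr_eq0 => /orP[] /eqP => [<-|->]; [right|left].
Qed.

End iid.

(** * Symmetric random walks *)

Lemma measurable_sublevel (R : realType) d (T : measurableType d) (f : T -> R)
  (C : R) : measurable_fun setT f -> measurable [set x | f x <= C].
Proof.
move=> mf; rewrite -[X in measurable X]setTI -preimage_itvNyc.
exact: mf.
Qed.

(** A pair of sequences is encoded as one family indexed by [bool * nat], so
that exchanging the sequences and shifting one or both of them are all
reindexings, to which [iid_reindex] applies. *)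
Section walk.
Context {R : realType}.
Implicit Types z : bool * nat -> R.

Definition partial_sum z b m : R := \sum_(i < m) z (b, i : nat).

Definition walk z m : R := partial_sum z true m - partial_sum z false m.

Definition shift n (p : bool * nat) := (p.1, (n + p.2)%N).
Definition unshift n (p : bool * nat) := (p.1, (p.2 - n)%N).
Definition swap (p : bool * nat) := (~~ p.1, p.2).
Definition lag k (p : bool * nat) := if p.1 then p else shift k p.
Definition unlag k (p : bool * nat) := if p.1 then p else unshift k p.

Lemma shiftK n : cancel (shift n) (unshift n).
Proof. by case=> b i; rewrite /shift /unshift /= addKn. Qed.

Lemma swapK : cancel swap swap.
Proof. by case=> b i; rewrite /swap /= negbK. Qed.

Lemma lagK k : cancel (lag k) (unlag k).
Proof. by case=> -[] i //; rewrite /lag /unlag /unshift /shift /= addKn. Qed.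

Lemma partial_sum_shift n z b m :
  partial_sum (z \o shift n) b m = partial_sum z b (n + m) - partial_sum z b n.
Proof. by rewrite /partial_sum big_split_ord /= [RHS]addrC addKr. Qed.

Lemma walk_shift n z m : walk (z \o shift n) m = walk z (n + m) - walk z n.
Proof. by rewrite /walk !partial_sum_shift; lra. Qed.

Lemma partial_sum_swap z b m : partial_sum (z \o swap) b m = partial_sum z (~~ b) m.
Proof. by []. Qed.

Lemma walk_swap z m : walk (z \o swap) m = - walk z m.
Proof. by rewrite /walk !partial_sum_swap opprB. Qed.

Lemma walk_lag k z m :
  walk (z \o lag k) m =
  partial_sum z true m - (partial_sum z false (k + m) - partial_sum z false k).
Proof. by rewrite /walk -partial_sum_shift. Qed.

Lemma measurable_walk m :
  measurable_fun setT (fun z : trajectory R (bool * nat)%type => walk z m).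
Proof.
by apply: measurable_funB; apply: measurable_sum => i; exact: measurable_coord.
Qed.

Definition walk_bounded_above : set (trajectory R (bool * nat)%type) :=
  [set z | exists C, forall m, walk z m <= C].

Definition walk_osc_le (C : R) : set (trajectory R (bool * nat)%type) :=
  [set z | forall m n, walk z n - walk z m <= C].

Lemma measurable_walk_bounded_above : measurable walk_bounded_above.
Proof.
rewrite [X in measurable X](_ : _ =
    \bigcup_k \bigcap_m [set z | walk z m <= k%:R]).
  apply: bigcup_measurable => k _; apply: bigcap_measurable => // m _.
  by apply: measurable_sublevel; exact: measurable_walk.
apply/seteqP; split=> [z [C zC]|z [k _ zk]]; last by exists k%:R => m; exact: zk.
exists (Num.bound `|C|) => // m _ /=.
by rewrite (le_trans (zC m))// (le_trans (ler_norm _))// ltW// archi_boundP.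
Qed.

Lemma measurable_walk_osc_le C : measurable (walk_osc_le C).
Proof.
rewrite [X in measurable X](_ : _ =
    \bigcap_m \bigcap_n [set z | walk z n - walk z m <= C]).
  apply: bigcap_measurable => // m _; apply: bigcap_measurable => // n _.
  by apply: (@measurable_sublevel _ _ (trajectory R _)); apply: measurable_funB;
    exact: measurable_walk.
by apply/seteqP; split=> [z zC m _ n _|z zC m n]; [exact: zC|exact: zC].
Qed.

Lemma walk_bounded_above_shift n z :
  walk_bounded_above (z \o shift n) <-> walk_bounded_above z.
Proof.
split=> -[C zC].
  exists (\sum_(i < n) `|walk z i| + `|C + walk z n|) => m.
  have [mn|nm] := ltnP m n.
    rewrite (bigD1 (Ordinal mn)) //= -addrA (le_trans (ler_norm _))// lerDl.
    by rewrite addr_ge0// sumr_ge0.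
  have := zC (m - n)%N; rewrite walk_shift subnKC// lerBlDr => /le_trans; apply.
  by rewrite (le_trans (ler_norm _))// lerDr sumr_ge0.
by exists (C - walk z n) => m; rewrite walk_shift lerB.
Qed.

End walk.

Section symmetric_walk.
Context {R : realType} {d : measure_display} {T : measurableType d}.
Context {P : probability T R}.
Variable Z : bool * nat -> {RV P >-> R}.
Hypothesis iZ : iid Z.
Variables c c' : R.
Hypothesis cc' : c < c'.
Hypothesis low : forall i, (0 < P (Z i @^-1` `]-oo, c]))%E.
Hypothesis high : forall i, (0 < P (Z i @^-1` `]c', +oo[))%E.

Let block n : {fset bool * nat} :=
  [fset p in [seq (b, i) | b <- [:: true; false], i <- iota 0 n]]%fset.

Let in_block n b i : ((b, i) \in block n) = (i < n)%N.
Proof.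
rewrite in_fset; apply/allpairsP/idP => [[[b' j] /= [_ + [_ ->]]]|ltin].
  by rewrite mem_iota.
by exists (b, i); split=> //=; [case: b|rewrite mem_iota].
Qed.

(** The event is stable under the shift by [n], and for [n (c' - c) > C] it
excludes that the first [n] increments all exceed [c' - c], an event of
positive probability [r] which is independent of what follows. Writing [p] for
the probability of the event, this gives [p + r p <= p]. *)
Lemma walk_osc_null C : P (sample Z id @^-1` walk_osc_le C) = 0%E.
Proof.
pose n := Num.bound `|C / (c' - c)|.
(* a step of the first sequence above [c'] and one of the second below [c] *)
pose B (p : bool * nat) : set R :=
  if p.1 then `]c', +oo[%classic else `]-oo, c]%classic.
have mB p : measurable (B p) by rewrite /B; case: ifP.
have c'c : 0 < c' - c by rewrite subr_gt0.
set E := walk_osc_le C; set F := cylinder (block n) B.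
have mE : measurable E by exact: measurable_walk_osc_le.
have mF : measurable (F : set (trajectory _ _)) by exact: measurable_cylinder.
have FE z : F z -> ~ E z.
  move=> Fz /(_ 0 n); apply/negP; rewrite -ltNge.
  rewrite /walk /partial_sum !big_ord0 !subr0 -sumrB.
  apply: (@lt_le_trans _ _ (\sum_(i < n) (c' - c))).
    rewrite sumr_const card_ord -mulr_natr -ltr_pdivrMl// mulrC.
    by rewrite (le_lt_trans (ler_norm _))// archi_boundP.
  apply: ler_sum => i _; apply: lerB.
    have := Fz (true, i : nat); rewrite in_block ltn_ord /B /= in_itv /= andbT.
    by move=> /(_ isT) /ltW.
  have := Fz (false, i : nat); rewrite in_block ltn_ord /B /= in_itv /=.
  exact.
pose E' := sample Z id @^-1` E; pose F' := sample Z id @^-1` F.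
pose S := sample Z (shift n) @^-1` E.
have E'S : E' `<=` S.
  move=> w Ew i j.
  have := Ew (n + i)%N (n + j)%N.
  rewrite !(walk_shift n (sample Z id w)) => ?; lra.
have mE' : measurable E' by exact: measurable_sampleP.
have mF' : measurable F' by exact: measurable_sampleP.
have mS : measurable S by exact: measurable_sampleP.
have F'0 : (0 < P F')%E.
  have -> : P F' = (\prod_(i <- block n) P (Z i @^-1` B i))%E.
    by rewrite -iZ.1.
  by elim/big_ind : _ => [//|? ? ? ?|[[] i] _]; [exact: mule_gt0| |].
have S_E' : P S = P E' by exact: (iid_reindex_law iZ (shiftK n)).
have FS : P (F' `&` S) = (P F' * P E')%E.
  apply: (iid_reindex iZ (shiftK n)) => // -[b i].
  by rewrite in_block -leqNgt leq_addr.
have : (P E' + P (F' `&` S) <= P E')%E.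
  rewrite -[leRHS]S_E' -measureU//; last 2 first.
  - exact: measurableI.
  - by apply/seteqP; split=> [w [Ew [/FE]]|].
  apply: le_measure; rewrite ?inE//.
    by apply: measurableU => //; exact: measurableI.
  by move=> w [/E'S|[]].
rewrite -[leRHS]adde0 leeD2lE ?fin_num_measure// FS => FE0.
apply/eqP; rewrite -measure_le0 leNgt; apply/negP => E'0.
by move: FE0; rewrite leNgt mule_gt0.
Qed.

(** Boundedness above and below have the same probability by symmetry, [0] or
[1] by the zero-one law, and their conjunction is null by [walk_osc_null]. *)
Lemma walk_not_bounded_above : P (sample Z id @^-1` walk_bounded_above) = 0%E.
Proof.
have mA := @measurable_walk_bounded_above R.
set A := walk_bounded_above in mA *.
pose A' := sample Z id @^-1` A; pose A'' := sample Z swap @^-1` A.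
have mA' : measurable A' by exact: measurable_sampleP.
have mA'' : measurable A'' by exact: measurable_sampleP.
have A''A' : P A'' = P A' by exact: (iid_reindex_law iZ swapK).
have null : P.-negligible (A' `&` A'').
  apply: (@negligibleS _ _ _ _ (\bigcup_k (sample Z id @^-1` walk_osc_le k%:R))).
    move=> w [[C wC] [C' wC']]; exists (Num.bound `|C + C'|) => // m n.
    have := lerD (wC n) (wC' m); rewrite (walk_swap (sample Z id w)).
    move=> /le_trans; apply; rewrite (le_trans (ler_norm _))//.
    by rewrite ltW// archi_boundP.
  apply: negligible_bigcup => k; apply/negligibleP; last exact: walk_osc_null.
  by apply: measurable_sampleP; exact: measurable_walk_osc_le.
have := iid_zero_one iZ mA; case=> // [J|A1].
  pose n := (\max_(p <- J) p.2).+1.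
  exists (shift n), (unshift n); split.
  - exact: shiftK.
  - move=> [b i]; apply/negP => biJ.
    have := @leq_bigmax_seq _ (enum_fset J) predT snd _ biJ isT.
    by move=> /(leq_trans (leq_addr i n)); rewrite ltnn.
  - by move=> z; exact: walk_bounded_above_shift.
have coN D : measurable D -> P D = 1%E -> P.-negligible (~` D).
  move=> mD D1; apply/negligibleP; first exact: measurableC.
  by apply: etrans (probability_setC P mD) _; rewrite D1 subee.
have /negligibleP : P.-negligible setT.
  apply: negligibleS (negligibleU null (negligibleU (coN _ mA' A1)
    (coN _ mA'' (etrans A''A' A1)))).
  by move=> w _; case: (pselect (A' w)) (pselect (A'' w)) => ? [] ?;
    [left|right; right|right; left|right; left].
move=> /(_ measurableT) /(etrans (esym (probability_setT P))) /eqP.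
by rewrite onee_eq0.
Qed.

(** Once one sequence has lost its first [k] terms, the difference of the partial
sums is again a symmetric walk, obtained by reindexing. *)
Lemma ae_partial_sum_lead : {ae P, forall w, forall b k C, exists m,
  C < partial_sum (sample Z id w) b m -
      (partial_sum (sample Z id w) (~~ b) (k + m) -
       partial_sum (sample Z id w) (~~ b) k)}.
Proof.
pose f b k := if b then lag k else swap \o lag k.
pose g b k := if b then unlag k else unlag k \o swap.
have fK b k : cancel (f b k) (g b k).
  by case: b; [exact: lagK|exact: can_comp swapK (lagK k)].
pose Q b k w := ~ walk_bounded_above (sample Z (f b k) w).
have aeQ b k : {ae P, forall w, Q b k w}.
  exists (sample Z (f b k) @^-1` walk_bounded_above); split.
  - by apply: measurable_sampleP; exact: measurable_walk_bounded_above.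
  - by rewrite -(walk_not_bounded_above) (iid_reindex_law iZ (fK b k))//;
      exact: measurable_walk_bounded_above.
  - by move=> w /= /contrapT.
apply: (filterS2 _ _ (ae_foralln (aeQ true)) (ae_foralln (aeQ false))).
move=> w Qt Qf b k C; apply: contrapT => /forallNP lead.
have bnd m : partial_sum (sample Z id w) b m -
    (partial_sum (sample Z id w) (~~ b) (k + m) -
     partial_sum (sample Z id w) (~~ b) k) <= C by rewrite leNgt; exact/negP.
case: b bnd {lead} => bnd.
  by apply: (Qt k); exists C => m; rewrite (walk_lag k (sample Z id w)).
apply: (Qf k); exists C => m; rewrite (walk_lag k (sample Z id w \o swap)).
exact: bnd.
Qed.

End symmetric_walk.

(** * The Mittag-Leffler law *)

(** [Gamma] is a real-valued integral, equal to [0] should the integral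
diverge, so positivity requires a lower and an upper bound. The latter is
[x `^ (z - 1) <= 1 + x <= 2 * expR (x / 2)], which bounds the integrand by a
multiple of the exponential density of rate [1 / 2]. *)
Lemma Gamma_gt0 (R : realType) (z : R) : 1 <= z <= 2 -> 0 < Gamma z.
Proof.
move=> /andP[z1 z2].
pose f (x : R) := x `^ (z - 1) * expR (- x).
have mf : measurable_fun setT f.
  apply: measurable_funM; first exact: measurable_powR.
  by apply: measurableT_comp => //; exact: measurable_oppr.
have f0 x : 0 <= f x by rewrite mulr_ge0 ?powR_ge0 ?expR_ge0.
have mfE D : measurable_fun D (EFin \o f).
  by apply/measurable_EFinP; exact: measurable_funTS.
rewrite /Gamma /Rintegral fine_gt0//; apply/andP; split.
  pose e2 := expR (- 2 : R).
  have ge : (e2%:E * lebesgue_measure (`[1%R, 2%R]%classic : set R) <=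
       \int[lebesgue_measure]_(x in `]0%R, +oo[) (f x)%:E)%E.
    rewrite -integral_cst//.
    apply: (@le_trans _ _ (\int[lebesgue_measure]_(x in `[1%R, 2%R]) (f x)%:E)%E).
      apply: ge0_le_integral => //.
      - by move=> x _; rewrite /= lee_fin expR_ge0.
      - exact: mfE.
      - move=> x /=; rewrite in_itv /= lee_fin => /andP[x1 x2].
        rewrite -[e2]mul1r ler_pM ?expR_ge0 ?ler_expR ?lerN2//.
        by have := @ler_powR _ x x1 0 (z - 1); rewrite powRr0; apply; lra.
    apply: ge0_subset_integral => //; [exact: mfE|by move=> x _; rewrite lee_fin|].
    by move=> x; rewrite /= !in_itv/= andbT => /andP[x1 _]; rewrite (lt_le_trans ltr01).
  apply: lt_le_trans ge.
  rewrite lebesgue_measure_itv /= lte_fin ltr1n /= -EFinD -EFinM lte_fin.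
  by rewrite mulr_gt0 ?expR_gt0//; lra.
have half : 0 < 2^-1 :> R by rewrite invr_gt0.
pose g (x : R) := 4 * exponential_pdf (2^-1 : R) x.
have g0 x : 0 <= g x by rewrite mulr_ge0 ?exponential_pdf_ge0 ?ltW.
have mg : measurable_fun setT (EFin \o g).
  apply/measurable_EFinP; apply: measurable_funM => //.
  exact: measurable_exponential_pdf.
apply: (@le_lt_trans _ _ (\int[lebesgue_measure]_x (g x)%:E)%E).
  apply: (@le_trans _ _ (\int[lebesgue_measure]_(x in `]0%R, +oo[) (g x)%:E)%E).
    apply: ge0_le_integral => //.
    - by move=> x _; rewrite lee_fin; exact: f0.
    - exact: mfE.
    - exact: measurable_funTS.
    - move=> x /=; rewrite in_itv /= andbT lee_fin => x0.
      rewrite /g exponential_pdfE ?(ltW x0)// /f.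
      have xz : x `^ (z - 1) <= 1 + x.
        have [x1|x1] := leP x 1.
          rewrite (@le_trans _ _ 1) ?lerDl ?(ltW x0)//.
          have z10 : 0 <= z - 1 by lra.
          have := @ge0_ler_powR _ (z - 1) z10 x 1.
          by rewrite !nnegrE powR1 (ltW x0) ler01 => ->.
        rewrite (@le_trans _ _ x) ?lerDr//.
        rewrite -[leRHS](powRr1 (ltW x0)) ler_powR ?(ltW x1)//; lra.
      have xe : 1 + x <= 2 * expR (x / 2).
        by have := expR_ge1Dx (x / 2); lra.
      have -> : expR (- x) = expR (- 2^-1 * x) * expR (- 2^-1 * x).
        by rewrite -expRD; congr expR; lra.
      have -> : 4 * (2^-1 * expR (- 2^-1 * x)) = 2 * expR (x / 2) *
         (expR (- 2^-1 * x) * expR (- 2^-1 * x)).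
        rewrite mulrA -[in RHS]mulrA [expR (x / 2) * _]mulrA -expRD.
        rewrite (_ : x / 2 + _ = 0) ?expR0; [lra|lra].
      by rewrite ler_wpM2r ?mulr_ge0 ?expR_ge0// (le_trans xz).
  by apply: ge0_subset_integral => // x _; rewrite lee_fin.
under eq_integral do rewrite EFinM.
rewrite ge0_integralZl//.
- by rewrite integral_exponential_pdf// mule1 ltry.
- by apply/measurable_EFinP; exact: measurable_exponential_pdf.
- by move=> x _; rewrite lee_fin exponential_pdf_ge0 ?ltW.
Qed.

Lemma geometric_sum_le2 (R : realFieldType) (t : R) n : 0 <= t -> t <= 2^-1 ->
  \sum_(i < n) t ^+ i <= 2.
Proof.
move=> t0 t2; elim: n => [|n IHn]; first by rewrite big_ord0.
rewrite big_ord_recl expr0; under eq_bigr do rewrite exprS.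
rewrite -mulr_sumr.
have : 0 <= \sum_(i < n) t ^+ i by apply: sumr_ge0 => i _; rewrite exprn_ge0.
by nra.
Qed.

(** Comparing the series at [- t r] with its value at [0], all terms of order
at least two are bounded by a multiple of [t ^+ 2], since the terms at [- r]
are bounded. So [t * r * u 1] is bounded by a multiple of [t ^+ 2] for small
[t]. *)
Lemma constant_power_series_coef1 (R : realType) (u : R^nat) (c r : R) : 0 < r ->
  (forall y, 0 <= y <= r -> series (fun l => (- y) ^+ l * u l) @ \oo --> c) ->
  u 1%N = 0.
Proof.
move=> r0 uc.
have r0r : 0 <= r <= r by rewrite lexx ltW.
have [C [C0 uC]] : exists C, 0 <= C /\ forall l, `|r ^+ l * u l| <= C.
  have : cvgn (series (fun l => (- r) ^+ l * u l)) by apply: cvgP (uc r r0r).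
  move=> /cvg_series_cvg_0 /cvgP /cvg_seq_bounded.
  move=> [M [_ /(_ (`|M| + 1))]] H.
  exists (`|M| + 1); split; first by rewrite addr_ge0.
  move=> l; have := H _ l I; rewrite /= !normrM !normrX normrN; apply.
  by rewrite (le_lt_trans (ler_norm _))// ltrDl.
have u0c : u 0%N = c.
  have h1 : series (fun l => (- 0) ^+ l * u l) @ \oo --> c.
    by apply: uc; rewrite lexx ltW.
  have h2 : series (fun l => (- 0) ^+ l * u l) @ \oo --> u 0%N.
    rewrite -(cvg_shiftS _); apply: cvg_near_cst; apply: nearW => n.
    rewrite /series /= big_nat_recl// expr0 mul1r big1 ?addr0// => i _.
    by rewrite oppr0 exprS !mul0r.
  by rewrite -(cvg_lim _ h2)// (cvg_lim _ h1).
have key t : 0 < t -> t <= 2^-1 -> r * `|u 1%N| <= 2 * C * t.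
  move=> t0 t2; rewrite -(ler_pM2l t0).
  have tr : 0 <= t * r <= r.
    by rewrite mulr_ge0 ?(ltW t0, ltW r0)//= ler_piMl ?(ltW r0)//; lra.
  have S := uc _ tr.
  have tail n : `|series (fun l => (- (t * r)) ^+ l * u l) (n + 2)%N - c + t * r * u 1%N|
       <= 2 * C * t * t.
    rewrite addn2 /series /= big_nat_recl// big_nat_recl// expr0 mul1r u0c expr1.
    rewrite [X in `|X|](_ : _ =
      \sum_(0 <= i < n) (- (t * r)) ^+ i.+2 * u i.+2); last first.
      by lra.
    rewrite big_mkord (le_trans (ler_norm_sum _ _ _))//.
    apply: (@le_trans _ _ (\sum_(i < n) C * t ^+ 2 * t ^+ i)).
      apply: ler_sum => i _.
      rewrite -mulrA -exprD normrM normrX normrN (gtr0_norm (mulr_gt0 t0 r0)).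
      rewrite exprMn -mulrA mulrC ler_wpM2r ?exprn_ge0 ?(ltW t0)//.
      by have := uC i.+2; rewrite normrM normrX (gtr0_norm r0).
    rewrite -mulr_sumr expr2.
    rewrite (_ : 2 * C * t * t = C * (t * t) * 2); last by lra.
    by rewrite ler_wpM2l ?geometric_sum_le2 ?(ltW t0)// ?mulr_ge0 ?(ltW t0).
  have : `|c - c + t * r * u 1%N| <= 2 * C * t * t.
    have S2 : series (fun l => (- (t * r)) ^+ l * u l) (n + 2)%N @[n --> \oo] --> c.
      by rewrite cvg_shiftn.
    have : `|series (fun l => (- (t * r)) ^+ l * u l) (n + 2)%N - c + t * r * u 1%N|
      @[n --> \oo] --> `|c - c + t * r * u 1%N|.
      by apply: cvg_norm; apply: cvgD; [apply: cvgB => //; exact: cvg_cst|exact: cvg_cst].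
    move=> h; rewrite -(cvg_lim _ h)//; apply: limr_le; first exact: cvgP h.
    exact: nearW.
  rewrite subrr add0r !normrM (gtr0_norm t0) (gtr0_norm r0); lra.
apply/eqP; rewrite -normr_le0 -(pmulr_rle0 _ r0) leNgt; apply/negP => a0.
set a := r * _ in a0 key.
(* a value of [t] at most [1 / 2] for which [2 * C * t < a] *)
have D0 : 0 < 4 * C + 2 * a by lra.
have t0 : 0 < a / (4 * C + 2 * a) by rewrite divr_gt0.
have t2 : a / (4 * C + 2 * a) <= 2^-1 by rewrite ler_pdivrMr//; lra.
by have := key _ t0 t2; rewrite mulrA ler_pdivlMr//; nra.
Qed.

Section mittag_leffler_law.
Context {R : realType} {d : measure_display} {T : measurableType d}.
Context {P : probability T R}.
Variable alpha : R.
Hypothesis a0 : 0 < alpha.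
Implicit Types X Y : {RV P >-> R}.

Definition scaled_rv (k : R) (X : {RV P >-> R}) : {RV P >-> R} :=
  [the {mfun T >-> R} of (cst k \* X)%R].

Lemma is_mittag_leffler_scaled lambda X : 0 < lambda ->
  is_mittag_leffler alpha lambda X -> is_mittag_leffler alpha 1 (scaled_rv lambda X).
Proof.
move=> l0 [X0 XP]; split=> [w|x x0]; first by rewrite /= mulr_gt0.
have -> : [set w | x < scaled_rv lambda X w] = [set w | x / lambda < X w].
  by apply/seteqP; split=> w /=; rewrite ltr_pdivrMr// mulrC.
rewrite XP ?divr_ge0 ?(ltW l0)// powR1 mul1r -powRM ?divr_ge0 ?(ltW l0)//.
by rewrite mulrCA divff ?mulr1// gt_eqF.
Qed.

Lemma is_mittag_leffler_law X Y : is_mittag_leffler alpha 1 X ->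
  is_mittag_leffler alpha 1 Y ->
  forall B, measurable B -> P (X @^-1` B) = P (Y @^-1` B).
Proof.
move=> [X0 XP] [Y0 YP] B mB.
change (distribution P X B = distribution P Y B).
apply: (measure_unique (@RGenOInfty.G R)
  (fun n => `](- n%:R), +oo[%classic)) mB => //.
- exact: RGenOInfty.measurableE.
- move=> _ _ [x ->] [y ->]; exists (Num.max x y).
  by apply/seteqP; split=> z /=; rewrite !in_itv /= !andbT gt_max => /andP.
- by move=> n; exists (- n%:R).
- apply/seteqP; split=> // x _; exists (Num.bound `|x|) => //=.
  rewrite in_itv /= andbT ltrNl (le_lt_trans (ler_norm _))// normrN.
  by rewrite archi_boundP.
- move=> _ [x ->]; rewrite /distribution /pushforward.
  have E (Z : {RV P >-> R}) : Z @^-1` `]x, +oo[ = [set w | x < Z w].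
    by rewrite preimage_itvoy.
  apply: (etrans (congr1 P (E X))); apply: etrans (esym (congr1 P (E Y))).
  have [x0|x0] := leP 0 x; first by rewrite XP// YP.
  by congr (P _); apply/seteqP; split=> w _ /=; rewrite (lt_trans x0).
- by move=> n; rewrite -ge0_fin_numE// fin_num_measure.
Qed.

(** Some tail probability [P (X > c')] with [0 < c'] is positive. If no [c < c']
were a suitable lower value, [P (X > c)] would equal [1] for [0 <= c < c'],
that is, the Mittag-Leffler power series would be constant on an interval. *)
Lemma is_mittag_leffler_nondegenerate X : alpha < 1 ->
  is_mittag_leffler alpha 1 X -> exists c c' : R, [/\ c < c',
    (0 < P (X @^-1` `]-oo, c]))%E & (0 < P (X @^-1` `]c', +oo[))%E].
Proof.
move=> a1 [X0 XP].
have [c' [c'0 Pc']] : exists c', 0 < c' /\ (0 < P (X @^-1` `]c', +oo[))%E.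
  apply: contrapT => /forallNP H.
  have : P.-negligible setT.
    apply: (@negligibleS _ _ _ _ (\bigcup_n (X @^-1` `](n.+1%:R^-1), +oo[))).
      move=> w _; exists (Num.bound (X w)^-1) => //=.
      rewrite in_itv /= andbT invf_plt ?posrE//.
      by rewrite (lt_le_trans (archi_boundP _)) ?invr_ge0 ?ler_nat// ltW.
    apply: negligible_bigcup => n; apply/negligibleP; first exact: measurable_funPTI.
    apply/eqP; rewrite -measure_le0 leNgt; apply/negP => Pn.
    by apply: (H n.+1%:R^-1); rewrite invr_gt0.
  move=> /negligibleP => /(_ measurableT) /(etrans (esym (probability_setT P))) /eqP.
  by rewrite onee_eq0.
apply: contrapT => H.
have H1 c : 0 <= c < c' -> mittag_leffler_fun alpha 1 (- (c `^ alpha)) = 1.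
  move=> /andP[c0 cc'].
  suff : P [set w | c < X w] = 1%E by rewrite XP// powR1 mul1r => -[].
  have Xc : P (X @^-1` `]-oo, c]) = 0%E.
    apply/eqP; rewrite -measure_le0 leNgt; apply/negP => Xc.
    by apply: H; exists c, c'.
  have := ccdf_1_cdf X c; rewrite /ccdf /cdf /distribution /pushforward Xc sube0.
  by rewrite preimage_itvoy.
pose r := (c' / 2) `^ alpha.
have c'2 : 0 < c' / 2 by rewrite divr_gt0.
have r0 : 0 < r by rewrite powR_gt0.
have a'0 : 0 <= alpha^-1 by rewrite invr_ge0 ltW.
have aN0 : alpha != 0 by rewrite gt_eqF.
pose u l : R := (Gamma (1 + alpha * l%:R))^-1.
have : u 1%N = 0.
  apply: (constant_power_series_coef1 (c := 1) r0) => y /andP[y0 yr].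
  have : mittag_leffler_fun alpha 1 (- y) = 1.
    have -> : y = (y `^ alpha^-1) `^ alpha by rewrite -powRrM mulVf// powRr1.
    rewrite H1// powR_ge0/=.
    have := ge0_ler_powR a'0 _ _ yr; rewrite !nnegrE y0 (ltW r0) => /(_ isT isT).
    rewrite /r -powRrM divff// powRr1 ?(ltW c'2)// => /le_lt_trans; apply; lra.
  rewrite /mittag_leffler_fun.
  (* a divergent series would have the default limit [0], not [1] *)
  have [cv <-//|/dvgP ->] :=
    pselect (cvgn (series (fun l => (- y) ^+ l / Gamma (1 + alpha * l%:R)))).
  by move=> /esym/eqP; rewrite (oner_eq0 R).
move/eqP; rewrite invr_eq0 gt_eqF// Gamma_gt0// mulr1.
by rewrite lerDl (ltW a0) /= (natrD _ 1 1) lerD2l ltW.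
Qed.

End mittag_leffler_law.

(** * Renewal epochs and counts *)

Lemma le_counting (R : realType) (A B : set nat) : A `<=` B ->
  (counting A <= counting B :> \bar R)%E.
Proof.
move=> AB; rewrite /counting; case: asboolP => [finA|infA].
  case: asboolP => [finB|_]; last exact: leey.
  by rewrite lee_fin ler_nat fsubset_leq_card// -fset_set_sub.
by rewrite asboolF// => /(sub_finite_set AB).
Qed.

Lemma counting_II (R : realType) n : counting `I_n = n%:R%:E :> \bar R.
Proof. by rewrite /counting asboolT// (card_fset_set (card_eqxx _)). Qed.

Definition falls_behind (R : realType) (T : Type) (X Y : nat -> T -> R)
    (w : T) : Prop :=
  forall k, exists n, renewal_epoch Y (k + n) w < renewal_epoch X n w.

Definition epochs_unbounded (R : realType) (T : Type) (X : nat -> T -> R)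
    (w : T) : Prop :=
  forall t, exists n, t < renewal_epoch X n w.

Section renewal_path.
Context {R : realType} {T : Type}.
Variables (X : nat -> T -> R) (w : T).
Hypothesis X0 : forall n, 0 < X n w.

Local Notation S n := (renewal_epoch X n w).
Local Notation N t := (renewal_count X t w).

Lemma renewal_epoch0 : S 0 = 0.
Proof. by rewrite /renewal_epoch big_ord0. Qed.

Lemma renewal_epochS n : S n.+1 = S n + X n w.
Proof. by rewrite /renewal_epoch big_ord_recr. Qed.

Lemma renewal_epoch_lt : {homo (fun n => S n) : m n / (m < n)%N >-> m < n}.
Proof.
apply: homo_ltn => [y x z|n]; first exact: lt_trans.
by rewrite renewal_epochS ltrDl.
Qed.

Lemma renewal_epoch_le m n : (m <= n)%N -> S m <= S n.
Proof.
by rewrite leq_eqVlt => /predU1P[->//|mn]; rewrite ltW ?renewal_epoch_lt.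
Qed.

(** Epochs increase, so the indices of those in [[0, t]] form an initial
segment. *)
Lemma renewal_count_ge n t : 0 <= t ->
  (n%:R%:E <= N t)%E = (S n <= t).
Proof.
move=> t0; apply/idP/idP => [|Sn].
  apply: contraTT; rewrite -!ltNge; case: n => [|n tS].
    by rewrite renewal_epoch0 ltNge t0.
  apply: (@le_lt_trans _ _ n%:R%:E); last by rewrite lte_fin ltr_nat.
  rewrite -counting_II; apply: le_counting => k /= Sk; rewrite ltnNge; apply/negP => nk.
  by move: tS; rewrite ltNge (le_trans _ Sk)// renewal_epoch_le.
rewrite -counting_II; apply: le_counting => k /= kn.
by rewrite (le_trans _ Sn)// renewal_epoch_le.
Qed.

Lemma renewal_count_lt n t : 0 <= t -> (N t < n%:R%:E)%E = (t < S n).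
Proof. by move=> t0; rewrite ltNge renewal_count_ge// ltNge. Qed.

Lemma renewal_count0 : N 0 = 0%E.
Proof.
apply/eqP; rewrite eq_le (renewal_count_ge 0)// renewal_epoch0 lexx andbT.
apply: (@le_trans _ _ (counting `I_0)); last by rewrite counting_II.
apply: le_counting => k /=.
by rewrite leNgt -renewal_epoch0 renewal_epoch_lt.
Qed.

Lemma renewal_count_nat t : (exists n, t < S n) ->
  exists n : nat, N t = n%:R%:E.
Proof.
move=> [n tS]; rewrite /renewal_count /counting asboolT; first by eexists.
apply: sub_finite_set (finite_II n) => k /= Sk; rewrite ltnNge; apply/negP => nk.
have := lt_le_trans tS (renewal_epoch_le (leqW nk)).
by rewrite ltNge Sk.
Qed.

Lemma renewal_count_le s t : s <= t -> (N s <= N t)%E.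
Proof.
by move=> st; apply: le_counting => k /= Sk; exact: le_trans st.
Qed.

(** The interval ends at the first epoch after [t]; if there is none, the count
has exploded and remains [+oo]. *)
Lemma renewal_count_right_const t :
  exists2 e, 0 < e & forall s, t <= s < t + e -> N s = N t.
Proof.
have [[n tS]|/forallNP tS] := pselect (exists n, t < S n.+1).
  have [m tSm mP] := ex_minnP (ex_intro (fun n => t < S n.+1) n tS).
  exists (S m.+1 - t); first by rewrite subr_gt0.
  move=> s /andP[ts]; rewrite subrKC => sS.
  rewrite /renewal_count; congr counting; apply/seteqP; split=> k /=; last first.
    by move=> /le_trans; exact.
  move=> Sk; rewrite leNgt; apply/negP => /mP mk.
  by have := lt_le_trans sS (renewal_epoch_le (mk : (m.+1 <= k.+1)%N)); rewrite ltNge Sk.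
exists 1; first exact: ltr01.
move=> s /andP[ts _]; rewrite /renewal_count; congr counting.
have St k : S k.+1 <= t by rewrite leNgt; exact/negP.
by apply/seteqP; split=> k //= _; exact: le_trans ts.
Qed.

End renewal_path.

Definition at_arbitrarily_large_times (R : realType) (T : Type)
    (f : R -> T -> \bar R) (B : set (\bar R)) : set T :=
  [set w | forall M : R, exists t, [/\ 0 <= t, M <= t & B (f t w)]].

(** By right constancy a time in the event can be replaced by a slightly larger
rational one, which turns the union over times into a countable one. *)
Lemma measurable_at_arbitrarily_large_times (R : realType) d
    (T : measurableType d) (f : R -> T -> \bar R) (B : set (\bar R)) :
  (forall t, 0 <= t -> measurable_fun setT (f t)) ->
  (forall t w, 0 <= t ->
    exists2 e, 0 < e & forall s, t <= s < t + e -> f s w = f t w) ->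
  measurable B -> measurable (at_arbitrarily_large_times f B).
Proof.
move=> mf rcf mB.
pose F (k : nat) (q : rat) : set T :=
  if (0 <= ratr q :> R) && (k%:R <= ratr q :> R) then f (ratr q) @^-1` B
  else set0.
rewrite [X in measurable X](_ : _ = \bigcap_k \bigcup_q F k q).
  apply: bigcap_measurable => // k _; apply: bigcupT_measurable_rat => q.
  rewrite /F; case: ifP => // /andP[q0 _].
  by rewrite -[X in measurable X]setTI; exact: mf.
apply/seteqP; split=> [w wB k _|w wB M].
  have [t [t0 kt Bt]] := wB k%:R.
  have [e e0 fe] := rcf t w t0.
  have [|q] := @rat_in_itvoo R t (t + e); first by rewrite ltrDl.
  rewrite in_itv /= => /andP[tq qte].
  exists q => //; rewrite /F (le_trans t0 (ltW tq)) (le_trans kt (ltW tq)) /=.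
  by rewrite fe// (ltW tq).
have [q _] := wB (Num.bound `|M|) I; rewrite /F.
case: ifP => // /andP[q0 kq] Bq; exists (ratr q); split=> //.
by rewrite (le_trans _ kq)// (le_trans (ler_norm _))// ltW// archi_boundP.
Qed.

Lemma limf_esup_pinftyP (R : realType) (f : R -> \bar R) :
  limf_esup f (pinfty_nbhs R) = +oo%E <->
  forall K : nat, forall M : R, exists t, [/\ 0 <= t, M <= t & (K%:R%:E < f t)%E].
Proof.
rewrite /limf_esup; split=> [fy K M|fP].
  apply: contrapT => /forallNP H.
  pose V := [set t | Num.max 0 M < t].
  have : (ereal_inf [set ereal_sup (f @` V) | V in pinfty_nbhs R] <= K%:R%:E)%E.
    apply: (@le_trans _ _ (ereal_sup (f @` V))).
      apply: ereal_inf_lbound; exists V => //.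
      by exists (Num.max 0 M); split=> //; exact: num_real.
    apply: ge_ereal_sup => _ [t tM <-]; rewrite leNgt; apply/negP => Kt.
    move: tM; rewrite /V /= gt_max => /andP[t0 Mt].
    by apply: (H t); split=> //; exact: ltW.
  by rewrite fy leye_eq.
apply/eqP; rewrite -leye_eq; apply: le_ereal_inf_tmp => _ [V [M [_ MV]] <-].
rewrite leye_eq; apply/eqP/eq_infty => r.
have [t [t0 Mt Kt]] := fP (Num.bound `|r|) (M + 1).
apply: (@le_trans _ _ (f t)); last first.
  apply: ereal_sup_ubound; exists t => //; apply: MV.
  by rewrite (lt_le_trans _ Mt)// ltrDl.
apply: le_trans (ltW Kt); rewrite lee_fin (le_trans (ler_norm _))// ltW//.
by rewrite archi_boundP.
Qed.

(** * The queue along one trajectory *)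

Section queue_path.
Context {R : realType} {T : Type}.
Variables (X1 X2 : nat -> T -> R) (w : T).
Hypothesis X1_gt0 : forall n, 0 < X1 n w.
Hypothesis X2_gt0 : forall n, 0 < X2 n w.

Local Notation S1 n := (renewal_epoch X1 n w).
Local Notation S2 n := (renewal_epoch X2 n w).
Local Notation N1 t := (renewal_count X1 t w).
Local Notation N2 t := (renewal_count X2 t w).
Local Notation Q := (queue_length (renewal_count X1) (renewal_count X2)).

Lemma netput_right_const t :
  exists2 e, 0 < e & forall s, t <= s < t + e -> N1 s = N1 t /\ N2 s = N2 t.
Proof.
have [e1 e10 h1] := renewal_count_right_const X1_gt0 t.
have [e2 e20 h2] := renewal_count_right_const X2_gt0 t.
exists (Num.min e1 e2); first by rewrite lt_min e10 e20.
move=> s /andP[ts]; rewrite -ltrBlDl lt_min => /andP[s1 s2].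
by rewrite h1 ?h2// ts -ltrBlDl.
Qed.

Lemma queue_length_right_const t : 0 <= t ->
  exists2 e, 0 < e & forall s, t <= s < t + e -> Q s w = Q t w.
Proof.
move=> t0; have [e e0 h] := netput_right_const t.
exists e => // s /andP[ts ste]; rewrite /queue_length.
have [-> ->] := h s (introT andP (conj ts ste)).
congr (_ - ereal_inf _)%E; apply/seteqP; split=> y [r] /=; rewrite in_itv /=.
- move=> /andP[r0 rs] <-; have [rt|tr] := leP r t.
    by exists r => //; rewrite /= in_itv /= r0.
  have [-> ->] : N1 r = N1 t /\ N2 r = N2 t.
    by apply: h; rewrite (ltW tr) (le_lt_trans rs).
  by exists t => //; rewrite /= in_itv /= t0 lexx.
- move=> /andP[r0 rt] <-; exists r => //.
  by rewrite /= in_itv /= r0 (le_trans rt).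
Qed.

Hypothesis S1y : epochs_unbounded X1 w.
Hypothesis S2y : epochs_unbounded X2 w.

Lemma queue_length_ge_netput t : 0 <= t -> (N1 t - N2 t <= Q t w)%E.
Proof.
move=> t0; rewrite /queue_length.
have [n1 ->] := renewal_count_nat X1_gt0 (S1y t).
have [n2 ->] := renewal_count_nat X2_gt0 (S2y t).
rewrite leeDl// oppe_ge0; apply: ereal_inf_lbound; exists 0.
  by rewrite /= in_itv /= lexx.
by rewrite !renewal_count0// sube0.
Qed.

Lemma netput_gt n t k : 0 <= t -> S1 (k + n) <= t -> t < S2 n ->
  (k%:R%:E < N1 t - N2 t)%E.
Proof.
move=> t0; rewrite -renewal_count_ge// -renewal_count_lt//.
have [n1 ->] := renewal_count_nat X1_gt0 (S1y t).
have [n2 ->] := renewal_count_nat X2_gt0 (S2y t).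
rewrite lee_fin lte_fin -EFinB lte_fin !ler_nat !ltr_nat ltrBrDr -natrD ltr_nat.
lia.
Qed.

(** The index [m.+1] exceeds the number of arrivals up to time [M], which forces
the time [S1 (K + m.+1 + n)] to be later than [M]. *)
Lemma queue_length_unbounded :
  falls_behind X2 X1 w ->
  forall (K : nat) (M : R), exists t, [/\ 0 <= t, M <= t & (K%:R%:E < Q t w)%E].
Proof.
move=> lead K M; pose M' := Num.max 0 M.
have M'0 : 0 <= M' by rewrite le_max lexx.
have [m Nm] := renewal_count_nat X1_gt0 (S1y M').
have [n S12] := lead (K + m.+1)%N.
have t0 : 0 <= S1 (K + m.+1 + n).
  by rewrite -[leLHS](renewal_epoch0 X1 w) renewal_epoch_le.
exists (S1 (K + m.+1 + n)); split=> //.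
  rewrite leNgt; apply/negP => tM.
  have : S1 (K + m.+1 + n) <= M' by rewrite le_max (ltW tM) orbT.
  rewrite -renewal_count_ge// Nm lee_fin ler_nat; lia.
apply: lt_le_trans (queue_length_ge_netput t0).
apply: le_lt_trans (netput_gt t0 (lexx _) S12).
by rewrite lee_fin ler_nat leq_addr.
Qed.

End queue_path.

Section queue_path_zeros.
Context {R : realType} {T : Type}.
Variables (X1 X2 : nat -> T -> R) (w : T).
Hypothesis X1_gt0 : forall n, 0 < X1 n w.
Hypothesis X2_gt0 : forall n, 0 < X2 n w.

Local Notation S1 n := (renewal_epoch X1 n w).
Local Notation S2 n := (renewal_epoch X2 n w).
Local Notation N1 t := (renewal_count X1 t w).
Local Notation N2 t := (renewal_count X2 t w).
Local Notation Q := (queue_length (renewal_count X1) (renewal_count X2)).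

Hypothesis S1y : epochs_unbounded X1 w.
Hypothesis S2y : epochs_unbounded X2 w.

(** Let [m] be the number of services up to [M], so that the netput is at least
[- m] until then, and let [s] be a time at which it is below [- m]. The
netput reaches its minimum over [[0, s]] after [M], and there the queue is
empty. *)
Lemma queue_length_zeros_unbounded :
  falls_behind X1 X2 w ->
  forall M : R, exists t, [/\ 0 <= t, M <= t & Q t w = 0%E].
Proof.
move=> lead M; pose M' := Num.max 0 M.
have M'0 : 0 <= M' by rewrite le_max lexx.
have [m Nm] := renewal_count_nat X2_gt0 (S2y M').
have [n S21] := lead m.+1.
pose s := S2 (m.+1 + n).
have s0 : 0 <= s.
  by rewrite -[leLHS](renewal_epoch0 X2 w) renewal_epoch_le.
have [p Np] := renewal_count_nat X2_gt0 (S2y s).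
(* [j] is the netput at [t] counted from the lower bound [- p] valid on [0, s] *)
have netput t : 0 <= t <= s -> exists j : nat,
    (N1 t - N2 t)%E = (j%:R - p%:R)%:E /\ ((N2 t <= m%:R%:E)%E -> (p <= j + m)%N).
  move=> /andP[t0 ts]; have [n1 Nn1] := renewal_count_nat X1_gt0 (S1y t).
  have [n2 Nn2] := renewal_count_nat X2_gt0 (S2y t).
  have := renewal_count_le X2 w ts; rewrite Nn1 Nn2 Np lee_fin ler_nat => n2p.
  exists (n1 + (p - n2))%N; split.
    by rewrite -EFinB natrD natrB//; congr EFin; lra.
  by rewrite lee_fin ler_nat; lia.
pose P j := `[< exists2 t, 0 <= t <= s & (N1 t - N2 t)%E = (j%:R - p%:R)%:E >].
have [js [js_eq _]] := netput s (introT andP (conj s0 (lexx s))).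
have Ps : P js by apply/asboolP; exists s; rewrite ?s0 ?lexx.
have [j /asboolP[t /andP[t0 ts] Dt] j_min] := ex_minnP (ex_intro P js Ps).
exists t; split=> //.
  rewrite leNgt; apply/negP => tM.
  have tM' : t <= M' by rewrite le_max (ltW tM) orbT.
  have := netput_gt X2_gt0 X1_gt0 S2y S1y s0 (lexx s) S21.
  have [n1 Nn1] := renewal_count_nat X1_gt0 (S1y s).
  have [j' [Dt' pj']] := netput t (introT andP (conj t0 ts)).
  move: Dt'; rewrite Dt => -[] /addIr /eqP; rewrite eqr_nat => /eqP jj'.
  have := pj' _; rewrite -Nm renewal_count_le// => /(_ isT).
  have := j_min _ Ps; move: js_eq; rewrite Np Nn1 -!EFinB => -[] /addIr /eqP.
  rewrite eqr_nat => /eqP <-; rewrite lte_fin ltrBrDr -natrD ltr_nat; lia.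
have -> : Q t w = ((N1 t - N2 t) - (N1 t - N2 t))%E.
  rewrite /queue_length; congr (_ - _)%E; apply/eqP; rewrite eq_le.
  rewrite ereal_inf_lbound/=; last by exists t => //=; rewrite in_itv /= t0 lexx.
  apply: le_ereal_inf_tmp => _ [r /= + <-]; rewrite in_itv /= => /andP[r0 rt].
  have rs : 0 <= r <= s by rewrite r0 (le_trans rt).
  have [i [Di _]] := netput r rs.
  rewrite Dt Di lee_fin lerB// ler_nat; apply: j_min.
  by apply/asboolP; exists r.
by rewrite Dt subee.
Qed.

End queue_path_zeros.

(** * Measurability and independence *)

Section measurability.
Context {R : realType} {d : measure_display} {T : measurableType d}.
Implicit Types X : nat -> T -> R.

Lemma measurable_renewal_epoch X n : (forall i, measurable_fun setT (X i)) ->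
  measurable_fun setT (renewal_epoch X n).
Proof. by move=> mX; apply: measurable_sum => i. Qed.

Lemma measurable_renewal_count X t : (forall i, measurable_fun setT (X i)) ->
  measurable_fun setT (renewal_count X t).
Proof.
move=> mX; rewrite (_ : renewal_count X t = fun w =>
    (\sum_(n <oo) \d_n [set k | renewal_epoch X k.+1 w <= t]%R)%E); last first.
  by apply/funext => w; rewrite -counting_dirac.
apply: ge0_emeasurable_sum => // k _; rewrite /dirac.
rewrite (_ : (fun _ => _) =
    EFin \o \1_[set w | renewal_epoch X k.+1 w <= t]); last first.
  by apply/funext => w /=; rewrite !indicE !mem_setE.
apply/measurable_EFinP/measurable_indic.
by rewrite -preimage_itvNyc -[X in measurable X]setTI; exact: measurable_renewal_epoch.
Qed.

(** The infimum over [[0, t]] is one over the rationals of that interval and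
[t] itself, by right constancy. The sequence [h] enumerates these times. *)
Lemma measurable_queue_length X1 X2 t :
  (forall i, measurable_fun setT (X1 i)) ->
  (forall i, measurable_fun setT (X2 i)) ->
  (forall i w, 0 < X1 i w) -> (forall i w, 0 < X2 i w) -> 0 <= t ->
  measurable_fun setT (queue_length (renewal_count X1) (renewal_count X2) t).
Proof.
move=> mX1 mX2 X1_gt0 X2_gt0 t0.
pose D s w := (renewal_count X1 s w - renewal_count X2 s w)%E.
have mD s : measurable_fun setT (D s).
  by apply: emeasurable_funB; exact: measurable_renewal_count.
pose h n : R := if choice.unpickle n is Some q then
  if 0 <= (ratr q : R) <= t then (ratr q : R) else t else t.
have h0t n : 0 <= h n <= t.
  by rewrite /h; case: choice.unpickle => [q|]; [case: ifP => //|]; rewrite t0 lexx.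
apply: emeasurable_funB; first exact: mD.
rewrite (_ : (fun _ => _) = (fun w => einfs (fun n => D (h n) w) 0%N)); last first.
  apply/funext => w; rewrite /einfs /sdrop /=; congr ereal_inf.
  apply/seteqP; split=> y /= [s].
    rewrite /= in_itv /= => /andP[s0 st] <-.
    have [->|sNt] := eqVneq s t.
      pose q : rat := (Num.trunc t).+1%:R.
      exists (choice.pickle q) => //; rewrite /h choice.pickleK ifF//.
      apply/negbTE; rewrite negb_and -!ltNge; apply/orP; right.
      by rewrite ratr_nat truncnS_gt.
    have [e e0 De] := netput_right_const (X1_gt0^~ w) (X2_gt0^~ w) s.
    have [|q] := @rat_in_itvoo R s (Num.min t (s + e)).
      by rewrite lt_min lt_neqAle sNt st ltrDl.
    rewrite in_itv /= lt_min => /andP[sq /andP[qt qe]].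
    exists (choice.pickle q) => //.
    rewrite /h choice.pickleK (le_trans s0 (ltW sq)) (ltW qt).
    by rewrite /D; have [-> ->] := De (ratr q) (introT andP (conj (ltW sq) qe)).
  by move=> _ <-; exists (h s) => //; rewrite /= in_itv /= h0t.
exact: measurable_fun_einfs.
Qed.

End measurability.

(** The event that the [k]-th epoch is at most [t] says that the count at time
[t] is at least [k]; steps are differences of consecutive epochs. *)
Lemma process_sigma_algebra_step (R : realType) d (T : measurableType d)
    (N : R -> T -> \bar R) (X : nat -> T -> R) n B :
  (forall i w, 0 < X i w) ->
  (forall t w, 0 <= t -> N t w = renewal_count X t w) ->
  measurable B -> process_sigma_algebra N (X n @^-1` B).
Proof.
move=> X0 NX mB.
rewrite /process_sigma_algebra; set G := (X in <<s X >>).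
pose T' := g_sigma_algebraType G.
have mS k : measurable_fun setT (renewal_epoch X k : T' -> R).
  apply: (measurability _ (RGenOInfty.measurableE R)).
  move=> _ [_ [x ->] <-]; rewrite setTI preimage_itvoy.
  have [x0|x0] := leP 0 x.
    rewrite [X in measurable X](_ : _ = N x @^-1` [set y | (y < k%:R%:E)%E]).
      apply: sub_sigma_algebra; exists x, [set y | (y < k%:R%:E)%E]; split=> //.
      rewrite [X in measurable X](_ : _ = [set` `]-oo, k%:R%:E[%E]).
        exact: emeasurable_itv.
      by apply/seteqP; split=> y /=; rewrite in_itv.
    by apply/seteqP; split=> w /=; rewrite NX// renewal_count_lt.
  rewrite [X in measurable X](_ : _ = setT)//.
  apply/seteqP; split=> // w _ /=.
  rewrite (lt_le_trans x0)// -[leLHS](renewal_epoch0 X w).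
  exact: renewal_epoch_le.
have -> : X n = (fun w => renewal_epoch X n.+1 w - renewal_epoch X n w).
  by apply/funext => w; rewrite renewal_epochS addrC addKr.
change (measurable (((fun w => renewal_epoch X n.+1 w - renewal_epoch X n w)
  : T' -> R) @^-1` B)).
rewrite -[X in measurable X]setTI.
by apply: measurable_funB.
Qed.

(** Independence of the counting processes, as sigma-algebras, makes the two
families of steps jointly independent: an event on finitely many steps splits
into one for each process. *)
Lemma independent_process_steps (R : realType) d (T : measurableType d)
    (P : probability T R) (N1 N2 : R -> T -> \bar R) (X1 X2 : nat -> {RV P >-> R}) :
  (forall i w, 0 < X1 i w) -> (forall i w, 0 < X2 i w) ->
  (forall t w, 0 <= t -> N1 t w = renewal_count X1 t w) ->
  (forall t w, 0 <= t -> N2 t w = renewal_count X2 t w) ->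
  independent_processes P N1 N2 ->
  mutually_independent X1 -> mutually_independent X2 ->
  mutually_independent (fun p : bool * nat => if p.1 then X1 p.2 else X2 p.2).
Proof.
move=> X1_gt0 X2_gt0 N1E N2E N12 iX1 iX2 J B mB.
have [slice sliceP] : exists slice : bool -> {fset nat},
    forall b i, (i \in slice b) = ((b, i) \in J).
  exists (fun b => [fset p.2 | p in J & p.1 == b]%fset) => b i.
  apply/imfsetP/idP => [[[b' j] /=]|bi].
    by rewrite inE /= => /andP[bJ /eqP <-] ->.
  by exists (b, i) => //=; rewrite inE /= bi eqxx.
have JE : J = ([fset (true, i) | i in slice true] `|`
               [fset (false, i) | i in slice false])%fset.
  apply/fsetP => -[b i]; rewrite inE; apply/idP/orP => [bi|].
    by case: b bi => bi; [left|right]; apply/imfsetP; exists i; rewrite ?sliceP.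
  by case=> /imfsetP[j /=]; rewrite sliceP => jJ [-> ->].
pose A1 := \bigcap_(i in [set` slice true]) (X1 i @^-1` B (true, i)).
pose A2 := \bigcap_(i in [set` slice false]) (X2 i @^-1` B (false, i)).
have JA : \bigcap_(p in [set` J])
    ((if p.1 then X1 p.2 else X2 p.2) @^-1` B p) = A1 `&` A2.
  apply/seteqP; split=> [w wJ|w [wA1 wA2] [[] i] /= iJ].
  - split=> i /=; rewrite sliceP.
      by move=> /(wJ (true, i)).
    by move=> /(wJ (false, i)).
  - by apply: wA1; rewrite /= sliceP.
  - by apply: wA2; rewrite /= sliceP.
have sigmaA (N : R -> T -> \bar R) (X : nat -> T -> R) (K : {fset nat})
    (C : nat -> set R) : (forall i w, 0 < X i w) ->
    (forall t w, 0 <= t -> N t w = renewal_count X t w) ->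
    (forall i, measurable (C i)) ->
    process_sigma_algebra N (\bigcap_(i in [set` K]) (X i @^-1` C i)).
  move=> X_gt0 NX mC; rewrite /process_sigma_algebra.
  set G := (G in <<s G >>).
  suff : @measurable _ (g_sigma_algebraType G)
    (\bigcap_(i in [set` K]) (X i @^-1` C i)) by [].
  apply: (@fin_bigcap_measurable _ (g_sigma_algebraType G)).
    exact: finite_fset.
  by move=> i _; exact: process_sigma_algebra_step NX (mC i).
rewrite JA N12; last 2 first.
- by apply: sigmaA => // i; exact: mB.
- by apply: sigmaA => // i; exact: mB.
rewrite /A1 /A2 (iX1 _ (fun i => B (true, i)))// (iX2 _ (fun i => B (false, i)))//.
rewrite [in RHS]JE prode_fsetU; last first.
  apply/fdisjointP => _ /imfsetP[i _ ->]; apply/imfsetP => -[j _].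
  by [].
by rewrite !big_imfset//= => i j _ _ [].
Qed.

Lemma mutually_independent_comp (R : realType) d (T : measurableType d)
    (P : probability T R) (I : choiceType) (X Y : I -> {RV P >-> R})
    (h : I -> R -> R) :
  (forall i, measurable_fun setT (h i)) ->
  (forall i w, Y i w = h i (X i w)) ->
  mutually_independent X -> mutually_independent Y.
Proof.
move=> mh Yh iX J B mB.
have YB i : Y i @^-1` B i = X i @^-1` (h i @^-1` B i).
  by apply/seteqP; split=> w /=; rewrite Yh.
under eq_bigcapr do rewrite YB.
rewrite iX; first by apply: eq_bigr => i _; rewrite YB.
by move=> i; rewrite -[X in measurable X]setTI; exact: mh.
Qed.

(** * Oscillation of the epochs *)

Lemma ae_probability1 (R : realType) d (T : measurableType d)
    (P : probability T R) (A : set T) :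
  measurable A -> {ae P, forall w, A w} -> P A = 1%E.
Proof.
move=> mA [E [mE E0 AE]].
have := probability_setC P mA; rewrite (subset_measure0 (measurableC mA) mE AE E0).
by move=> /esym /eqP; rewrite sube_eq ?fin_num_measure// add0e => /eqP.
Qed.

(** Rescaled to unit scale, all steps form one family of independent and
identically distributed variables, to which [ae_partial_sum_lead] applies. The
comparison of [lambda] with [mu] tells for which of the two processes an
inequality between rescaled epochs implies one between the epochs. *)
Lemma ae_epoch_lead (R : realType) d (T : measurableType d)
    (P : probability T R) (alpha lambda mu : R) (X1 X2 : nat -> {RV P >-> R}) :
  0 < alpha -> alpha < 1 -> 0 < lambda -> 0 < mu ->
  (forall n, is_mittag_leffler alpha lambda (X1 n)) ->
  (forall n, is_mittag_leffler alpha mu (X2 n)) ->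
  mutually_independent (fun p : bool * nat => if p.1 then X1 p.2 else X2 p.2) ->
  {ae P, forall w,
    [/\ epochs_unbounded X1 w, epochs_unbounded X2 w,
        lambda <= mu -> falls_behind X1 X2 w &
        mu <= lambda -> falls_behind X2 X1 w]}.
Proof.
move=> a0 a1 l0 m0 ml1 ml2 ind.
pose rate b := if b then lambda else mu.
pose Z (p : bool * nat) : {RV P >-> R} :=
  scaled_rv (rate p.1) (if p.1 then X1 p.2 else X2 p.2).
have mlZ p : is_mittag_leffler alpha 1 (Z p).
  by case: p => -[] n; apply: is_mittag_leffler_scaled.
have iZ : iid Z.
  split; last by move=> p q; exact: is_mittag_leffler_law.
  apply: (@mutually_independent_comp _ _ _ _ _ _ Z (fun p x => rate p.1 * x) _ _ ind).
    by move=> p; apply: measurable_funM.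
  by case=> -[].
have [c [c' [cc' low high]]] := is_mittag_leffler_nondegenerate a0 a1 (mlZ (true, 0%N)).
have lowZ p : (0 < P (Z p @^-1` `]-oo, c]))%E.
  by rewrite (is_mittag_leffler_law (mlZ p) (mlZ (true, 0%N))).
have highZ p : (0 < P (Z p @^-1` `]c', +oo[))%E.
  by rewrite (is_mittag_leffler_law (mlZ p) (mlZ (true, 0%N))).
apply: filterS (ae_partial_sum_lead iZ cc' lowZ highZ) => w lead.
have X1_gt0 n : 0 < X1 n w by have [] := ml1 n.
have X2_gt0 n : 0 < X2 n w by have [] := ml2 n.
pose S b n := renewal_epoch (if b then X1 else X2) n w.
have ZS b n : partial_sum (sample Z id w) b n = rate b * S b n.
  by rewrite /partial_sum mulr_sumr; case: b.
have S0 b n : 0 <= S b n.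
  by apply: sumr_ge0 => i _; case: b; exact: ltW.
have rate0 b : 0 < rate b by case: b.
have Sy b t : exists n, t < S b n.
  have [n] := lead b 0%N (rate b * t); rewrite !ZS => lt_n.
  exists n; rewrite -(ltr_pM2l (rate0 b)) (lt_le_trans lt_n)// gerBl.
  by rewrite [S _ 0%N]big_ord0 mulr0 subr0 mulr_ge0// ltW.
have Slead b k : rate b <= rate (~~ b) -> exists n, S (~~ b) (k + n)%N < S b n.
  move=> le_rate; have [n] := lead b k (rate (~~ b) * S (~~ b) k).
  rewrite !ZS => lt_n; exists n; rewrite -(ltr_pM2l (rate0 (~~ b))).
  have : rate b * S b n <= rate (~~ b) * S b n by rewrite ler_wpM2r.
  lra.
split.
- exact: (Sy true).
- exact: (Sy false).
- by move=> lm k; exact: (Slead true).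
- by move=> ml k; exact: (Slead false).
Qed.

Lemma mittag_leffler_queue_epochs (R : realType) d (T : measurableType d)
    (P : probability T R) (alpha lambda mu : R) (L : R -> T -> \bar R) :
  0 < alpha -> alpha < 1 -> 0 < lambda -> 0 < mu ->
  mittag_leffler_queue P alpha alpha lambda mu L ->
  exists X1 X2 : nat -> {RV P >-> R},
    [/\ (forall i w, 0 < X1 i w) /\ (forall i w, 0 < X2 i w),
        forall t w, 0 <= t ->
          L t w = queue_length (renewal_count X1) (renewal_count X2) t w &
        {ae P, forall w,
          [/\ epochs_unbounded X1 w, epochs_unbounded X2 w,
              lambda <= mu -> falls_behind X1 X2 w &
              mu <= lambda -> falls_behind X2 X1 w]}].
Proof.
move=> a0 a1 l0 m0.
move=> [N1 [N2 [[X1 [iX1 ml1 N1E]] [X2 [iX2 ml2 N2E]] N12 LE]]].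
have [X1_gt0 X2_gt0] : (forall i w, 0 < X1 i w) /\ (forall i w, 0 < X2 i w).
  by split=> i w; [have [] := ml1 i|have [] := ml2 i].
exists X1, X2; split=> [//|t w t0|].
  rewrite LE// /queue_length N1E// N2E//; congr (_ - ereal_inf _)%E.
  by apply/seteqP; split=> y [s /= sI <-]; exists s => //;
    move: sI; rewrite in_itv /= => /andP[s0 _]; rewrite N1E// N2E.
exact: (ae_epoch_lead a0 a1 l0 m0 ml1 ml2
  (independent_process_steps X1_gt0 X2_gt0 N1E N2E N12 iX1 iX2)).
Qed.

Theorem theorem3p8 (R : realType) (alpha lambda mu : R) :
  0 < alpha -> alpha < 1 -> 0 < lambda -> 0 < mu ->
  (lambda <= mu ->
     forall (d : measure_display) (T : measurableType d) (P : probability T R)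
            (L : R -> T -> \bar R),
     mittag_leffler_queue P alpha alpha lambda mu L ->
     P (zero_infinitely_often L) = 1%E) /\
  (mu <= lambda ->
     exists c : R, 0 < c /\
     forall (d : measure_display) (T : measurableType d) (P : probability T R)
            (L : R -> T -> \bar R),
     mittag_leffler_queue P alpha alpha lambda mu L ->
     (c%:E < P (limsup_infinite L))%E).
Proof.
move=> a0 a1 l0 m0; split=> [lm d T P L|ml].
  case/(mittag_leffler_queue_epochs a0 a1 l0 m0) => X1 [X2 [[X1_gt0 X2_gt0] LQ lead]].
  set Q := queue_length _ _ in LQ.
  have -> : zero_infinitely_often L = at_arbitrarily_large_times Q [set 0%E].
    by apply/seteqP; split=> w wL M; have [t [t0 Mt Lt]] := wL M;
      exists t; move: Lt; rewrite /= LQ.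
  apply: ae_probability1.
    apply: measurable_at_arbitrarily_large_times => //.
    - by move=> t t0; exact: measurable_queue_length.
    - by move=> t w; exact: queue_length_right_const.
  apply: filterS lead => w [S1y S2y lead _].
  by apply: queue_length_zeros_unbounded => //; exact: lead.
(* the probability is [1], so that any constant below [1] works *)
exists 2^-1; split; first by rewrite invr_gt0.
move=> d T P L.
case/(mittag_leffler_queue_epochs a0 a1 l0 m0) => X1 [X2 [[X1_gt0 X2_gt0] LQ lead]].
set Q := queue_length _ _ in LQ.
have -> : limsup_infinite L =
    \bigcap_(K : nat) at_arbitrarily_large_times Q `]K%:R%:E, +oo%E]%classic.
  apply/seteqP; split=> w.
    move=> /limf_esup_pinftyP wL K _ M; have [t [t0 Mt Lt]] := wL K M.
    by exists t; split=> //=; rewrite in_itv /= leey andbT -LQ.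
  move=> wQ; apply/limf_esup_pinftyP => K M; have [t [t0 Mt]] := wQ K I M.
  by rewrite /= in_itv /= leey andbT => Qt; exists t; rewrite LQ.
suff -> : P (\bigcap_(K : nat)
    at_arbitrarily_large_times Q `]K%:R%:E, +oo%E]%classic) = 1%E.
  by rewrite lte_fin invf_lt1// ltr1n.
apply: ae_probability1.
  apply: bigcap_measurable => // K _.
  apply: measurable_at_arbitrarily_large_times => //.
  - by move=> t t0; exact: measurable_queue_length.
  - by move=> t w; exact: queue_length_right_const.
  - exact: emeasurable_itv.
apply: filterS lead => w [S1y S2y _ lead] K _ M.
have [t [t0 Mt Qt]] :=
  queue_length_unbounded (X1_gt0^~ w) (X2_gt0^~ w) S1y S2y (lead ml) K M.
by exists t; split=> //=; rewrite in_itv /= leey andbT.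
Qed.
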